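(* Let $G$ be an $n$-vertex PLB graph with parameters $\alpha$ and $t$. Then algorithm CountTriangles computes the number of triangles in $G$ in time (a) $O(n^{3/\alpha}(t+1)^{3-3/\alpha})$ if $1<\alpha<3$; (b) $O(n\log n\,(t+1)^2)$ if $\alpha=3$; (c) $O(n(t+1)^2)$ if $\alpha>3$.
   Context: Graphs are finite, simple, undirected; $n$ is the number of vertices; $\log$ is binary. Fix a universal constant $c_1>0$. An $n$-vertex graph $G$ is power law bounded (PLB) with parameters $\alpha$ and $t$ (where $\alpha>1$ is a constant and $t\ge 0$ is real) if for every integer $d\ge 0$ the number of vertices $v$ with $\deg(v)\in[2^d,2^{d+1})$ is at most $c_1 n(t+1)^{\alpha-1}\sum_{i=2^d}^{2^{d+1}-1}(i+t)^{-\alpha}$. $O(\cdot)$ hides constants depending only on $c_1,\alpha$. Let $v_1,\dots,v_n$ be the vertices sorted in non-decreasing order of degree, and let $\vec G$ be obtained by orienting each edge $v_iv_j$ towards $v_{\max(i,j)}$. Algorithm CountTriangles($G$): build $\vec G$; set a counter to $0$; for each vertex $v$, let $S$ be the set of out-neighbors of $v$ in $\vec G$ (stored as a Boolean array); for each in-edge $wv$ of $v$ in $\vec G$ and each out-edge $wu$ of $w$ in $\vec G$, if $u\in S$ increment the counter; return the counter. *)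

(* Defs.v *)
From HB Require Import structures.
From mathcomp Require Import all_boot all_order all_algebra.
From mathcomp Require Import all_classical all_reals all_analysis.

Set Implicit Arguments.
Unset Strict Implicit.
Unset Printing Implicit Defensive.

Import Order.TTheory GRing.Theory Num.Theory.

Record sgraph (n : nat) := SGraph {
  edge : rel 'I_n;
  edge_sym : symmetric edge;
  edge_irr : irreflexive edge
}.

Definition deg (n : nat) (G : sgraph n) (v : 'I_n) : nat :=
  #|[set u | edge G v u]|.

Definition triangles (n : nat) (G : sgraph n) : {set {set 'I_n}} :=
  [set A : {set 'I_n} | (#|A| == 3) &&
    [forall x in A, forall y in A, (x != y) ==> edge G x y]].

Section PowerLaw.
Local Open Scope ring_scope.

Definition PLB (R : realType) (c1 alpha t : R) (n : nat) (G : sgraph n) : Prop :=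
  forall d : nat,
    (#|[set v | (2 ^ d <= deg G v)%N && (deg G v < 2 ^ d.+1)%N]|)%:R <=
      c1 * n%:R * (t + 1) `^ (alpha - 1)
         * \sum_(2 ^ d <= i < 2 ^ d.+1) (i%:R + t) `^ (- alpha).

Definition log2 (R : realType) (x : R) : R := ln x / ln 2.

End PowerLaw.

(* Running time is the number of steps of a unit-cost random access machine.
   Programs are written in a small imperative language over natural-number
   registers and arrays, with bounded loops; every value that [CountTriangles]
   computes is polynomial in n, so that unit-cost arithmetic is legitimate. *)

Inductive reg := rN | rV | rW | rU | rD | rJ | rK | rP | rCount.

(* aOff, aAdj : input adjacency lists, see [encodes]
   aBucket    : counting sort of the vertices by degree
   aPos       : position of a vertex in the sorted order v_1, ..., v_n
   aOut, aOutN, aIn, aInN : out- and in-neighbours in the oriented graph, and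
                their numbers; the lists of v start at aOff[v], as in the input
   aS         : Boolean array (0/1) of the set S *)
Inductive arr :=
  aOff | aAdj | aCnt | aBucket | aPos | aOut | aOutN | aIn | aInN | aS.

Scheme Boolean Equality for reg.
Scheme Boolean Equality for arr.

Record store := Store { regs : reg -> nat; arrs : arr -> nat -> nat }.

Definition set_reg (s : store) (x : reg) (k : nat) : store :=
  Store (fun y => if reg_beq y x then k else regs s y) (arrs s).

Definition set_arr (s : store) (a : arr) (i k : nat) : store :=
  Store (regs s)
    (fun b j => if arr_beq b a && (j == i) then k else arrs s b j).

Inductive expr :=
  | Const of nat
  | Reg of reg
  | Read of arr & expr
  | Add of expr & expr
  | Sub of expr & expr
  | Less of expr & expr.

Inductive cmd :=
  | Assign of reg & expr
  | Write of arr & expr & expr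
  | Seq of cmd & cmd
  | When of expr & cmd
  | For of reg & expr & cmd.

Fixpoint eval (s : store) (e : expr) : nat :=
  match e with
  | Const k => k
  | Reg x => regs s x
  | Read a e1 => arrs s a (eval s e1)
  | Add e1 e2 => eval s e1 + eval s e2
  | Sub e1 e2 => eval s e1 - eval s e2
  | Less e1 e2 => eval s e1 < eval s e2
  end.

Fixpoint ecost (e : expr) : nat :=
  match e with
  | Const _ | Reg _ => 1
  | Read _ e1 => (ecost e1).+1
  | Add e1 e2 | Sub e1 e2 | Less e1 e2 => (ecost e1 + ecost e2).+1
  end.

(* Final store and number of steps. [For x e c] evaluates the bound [e] once
   and runs [c] with x = 0, ..., e - 1 in this order. *)
Fixpoint exec (c : cmd) (s : store) : store * nat :=
  match c with
  | Assign x e => (set_reg s x (eval s e), (ecost e).+1)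
  | Write a i e => (set_arr s a (eval s i) (eval s e), (ecost i + ecost e).+1)
  | Seq c1 c2 =>
      let r1 := exec c1 s in
      let r2 := exec c2 r1.1 in
      (r2.1, r1.2 + r2.2)
  | When e c1 =>
      if eval s e == 0 then (s, (ecost e).+1)
      else let r := exec c1 s in (r.1, (ecost e).+1 + r.2)
  | For x e c1 =>
      iteri (eval s e)
        (fun i r => let r' := exec c1 (set_reg r.1 x i) in
                    (r'.1, (r.2 + r'.2).+1))
        (s, (ecost e).+1)
  end.

Declare Scope ram_scope.
Delimit Scope ram_scope with ram.
Bind Scope ram_scope with expr.
Bind Scope ram_scope with cmd.
#[local] Coercion Const : nat >-> expr.
#[local] Coercion Reg : reg >-> expr.
Local Notation "e1 + e2" := (Add e1 e2) : ram_scope.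
Local Notation "e1 - e2" := (Sub e1 e2) : ram_scope.
Local Notation "e1 < e2" := (Less e1 e2) : ram_scope.
Local Notation "a ![ i ]" := (Read a i%ram) (at level 8, format "a ![ i ]") : ram_scope.
Local Notation "x <~ e" := (Assign x e%ram) (at level 75) : ram_scope.
Local Notation "a ![ i ] <~ e" := (Write a i%ram e%ram)
  (at level 8, e at level 74) : ram_scope.
Local Notation "c1 ;; c2" := (Seq c1%ram c2%ram)
  (at level 90, right associativity) : ram_scope.

Section CountTriangles.
Local Open Scope ram_scope.

Definition degree (v : reg) : expr := aOff![v + 1] - aOff![v].

Definition SortByDegree : cmd :=
  For rD rN (aCnt![rD] <~ 0) ;;
  For rV rN (aCnt![degree rV] <~ aCnt![degree rV] + 1) ;;
  rP <~ 0 ;;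
  For rD rN (
    aBucket![rD] <~ rP ;;
    rP <~ rP + aCnt![rD]) ;;
  For rV rN (
    aPos![rV] <~ aBucket![degree rV] ;;
    aBucket![degree rV] <~ aBucket![degree rV] + 1).

Definition Orient : cmd :=
  For rV rN (
    aOutN![rV] <~ 0 ;;
    aInN![rV] <~ 0) ;;
  For rV rN (
    For rK (degree rV) (
      rU <~ aAdj![aOff![rV] + rK] ;;
      When (aPos![rV] < aPos![rU]) (
        aOut![aOff![rV] + aOutN![rV]] <~ rU ;;
        aOutN![rV] <~ aOutN![rV] + 1 ;;
        aIn![aOff![rU] + aInN![rU]] <~ rV ;;
        aInN![rU] <~ aInN![rU] + 1))).

Definition SetS (b : nat) : cmd :=
  For rK aOutN![rV] (aS![aOut![aOff![rV] + rK]] <~ b).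

Definition CountTriangles : cmd :=
  SortByDegree ;;
  Orient ;;
  rCount <~ 0 ;;
  For rU rN (aS![rU] <~ 0) ;;
  For rV rN (
    SetS 1 ;;
    For rJ aInN![rV] (
      rW <~ aIn![aOff![rV] + rJ] ;;
      For rK aOutN![rW] (
        rU <~ aOut![aOff![rW] + rK] ;;
        When aS![rU] (rCount <~ rCount + 1))) ;;
    SetS 0).

End CountTriangles.

(* The input: vertices are 0, ..., n - 1 and the neighbours of v are listed, in
   any order, in the cells aOff[v], ..., aOff[v+1] - 1 of aAdj. The rest of
   the store is arbitrary. *)
Definition encodes (n : nat) (G : sgraph n) (s : store) : Prop :=
  [/\ regs s rN = n,
      arrs s aOff 0 = 0,
      forall v : 'I_n, arrs s aOff v.+1 = arrs s aOff v + deg G v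
    & forall v : 'I_n,
        perm_eq [seq arrs s aAdj (arrs s aOff v + k) | k <- iota 0 (deg G v)]
                [seq val u | u <- enum [set u | edge G v u]]].

(* Main.v *)
Require Import Defs.
From HB Require Import structures.
From mathcomp Require Import all_boot all_order all_algebra.
From mathcomp Require Import all_classical all_reals all_analysis.
From mathcomp Require Import zify ring lra.

(* The position of v after the counting sort is the number of vertices that
   precede v in the lexicographic order on (degree, index); hence every triangle
   is counted once, with w its first and u its last vertex. Charging each
   in-edge wv the out-degree of w bounds the running time by
   O(n + sum_w out(w)^2).

   Put kappa = n (t+1)^(alpha-1). At most O(kappa 2^((1-alpha)e)) vertices have
   their degree in [2^e, 2^(e+1)), and their out-degrees are below 2^(e+1), so
   they contribute O(kappa 2^((3-alpha)e)) to the sum of squares.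
   - For alpha > 3 this decreases geometrically; where 2^e <= t+1 it is replaced
     by kappa 8^e (t+1)^(-alpha).
   - For alpha = 3 each of the log n scales contributes O(kappa).
   - For alpha < 3 it increases, and we stop at D = kappa^(1/alpha). Only
     O(kappa D^(1-alpha)) = O(D) vertices have degree above D, and the
     out-neighbours of each of them are among them: they contribute O(D^3). *)

Set Implicit Arguments.
Unset Strict Implicit.
Unset Printing Implicit Defensive.

Import Order.TTheory GRing.Theory Num.Theory.

(** * Cost semantics *)

(** A Hoare-style specification with a time budget. Loops are bounded, so [exec] is total and
    termination needs no separate claim. *)
Definition ends (c : cmd) (s : store) (Q : store -> Prop) (T : nat) : Prop :=
  Q (exec c s).1 /\ (exec c s).2 <= T.

Fixpoint writes_arr (c : cmd) (a : arr) : bool :=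
  match c with
  | Assign _ _ => false
  | Write b _ _ => arr_beq a b
  | Seq c1 c2 => writes_arr c1 a || writes_arr c2 a
  | When _ c1 | For _ _ c1 => writes_arr c1 a
  end.

Fixpoint assigns_reg (c : cmd) (x : reg) : bool :=
  match c with
  | Assign y _ => reg_beq x y
  | Write _ _ _ => false
  | Seq c1 c2 => assigns_reg c1 x || assigns_reg c2 x
  | When _ c1 => assigns_reg c1 x
  | For y _ c1 => reg_beq x y || assigns_reg c1 x
  end.

(** A syntactic footprint: whatever the text of [c] never writes is preserved. This carries facts
    about the input and about earlier phases past a command without repeating them in its
    postcondition. *)
Definition frame (c : cmd) (s s' : store) : Prop :=
  (forall a, writes_arr c a = false -> arrs s' a = arrs s a) /\
  (forall x, assigns_reg c x = false -> regs s' x = regs s x).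

Lemma frame_exec c s : frame c s (exec c s).1.
Proof.
elim: c s => [x e|a i e|c1 IH1 c2 IH2|e c1 IH1|x e c1 IH1] s /=.
- by split => // y /= ->.
- by split => //= b /= ->.
- case: (IH1 s) => A1 R1; case: (IH2 (exec c1 s).1) => A2 R2.
  by split => z /= /norP[/negbTE n1 /negbTE n2]; rewrite ?A2 ?A1 ?R2 ?R1.
- by case: eqP => _; [split | apply: IH1].
- elim: (Defs.eval s e) => [|m IHm] /=; first by split.
  case: IHm => Am Rm; set s1 := set_reg _ x m; case: (IH1 s1) => A1 R1.
  split => [a /= na|y /= /norP[/negbTE n1 /negbTE n2]].
    by rewrite A1 // -Am.
  by rewrite R1 //= n1 -Rm //= n1 n2.
Qed.

Lemma ends_weaken c s (Q Q' : store -> Prop) T T' :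
  ends c s Q T -> (forall s', frame c s s' -> Q s' -> Q' s') -> T <= T' ->
  ends c s Q' T'.
Proof.
case=> HQ HT QQ' TT'; split; last exact: leq_trans TT'.
by apply: QQ' HQ; apply: frame_exec.
Qed.

Lemma ends_seq c1 c2 s (Q1 Q2 : store -> Prop) T1 T2 :
  ends c1 s Q1 T1 ->
  (forall s1, frame c1 s s1 -> Q1 s1 -> ends c2 s1 Q2 T2) ->
  ends (Seq c1 c2) s Q2 (T1 + T2).
Proof.
case=> HQ HT H; case: (H _ (frame_exec c1 s) HQ) => HQ2 HT2.
by split => //=; apply: leq_add.
Qed.

(** Loop rule with a budget [f i] that may vary with the iteration. The body may assume the frame
    relative to the start of the whole loop, so the invariant [I] only has to mention what the loop
    changes. *)
Lemma ends_for (I : nat -> store -> Prop) (f : nat -> nat) N x e c s :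
  Defs.eval s e = N -> I 0 s ->
  (forall i s', i < N -> frame (For x e c) s s' -> I i s' ->
     ends c (set_reg s' x i) (I i.+1) (f i)) ->
  ends (For x e c) s (I N) ((ecost e).+1 + \sum_(i < N) (f i).+1).
Proof.
move=> eN I0 step.
pose body i (r : store * nat) := let r' := exec c (set_reg r.1 x i) in
  (r'.1, (r.2 + r'.2).+1).
pose r i := iteri i body (s, (ecost e).+1).
suff H i : i <= N -> [/\ I i (r i).1, frame (For x e c) s (r i).1
    & (r i).2 <= (ecost e).+1 + \sum_(j < i) (f j).+1].
  by rewrite /ends /= eN; case: (H N (leqnn N)).
elim: i => [|i IH] lt_iN; first by split => //=; rewrite big_ord0 addn0.
case: (IH (ltnW lt_iN)) => Ii [Fa Fr] Ti.
case: (step i (r i).1 lt_iN) => // [IS TS]; split.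
- exact: IS.
- case: (frame_exec c (set_reg (r i).1 x i)) => A1 R1.
  split => [a /= na|y /= /norP[/negbTE n1 /negbTE n2]]; first by rewrite A1 // -Fa.
  by rewrite R1 //= n1 Fr //= n1 n2.
- by rewrite big_ord_recr /= addnA; move: Ti TS; rewrite /r /=; lia.
Qed.

Lemma ends_for_const (I : nat -> store -> Prop) K N x e c s :
  Defs.eval s e = N -> I 0 s ->
  (forall i s', i < N -> frame (For x e c) s s' -> I i s' ->
     ends c (set_reg s' x i) (I i.+1) K) ->
  ends (For x e c) s (I N) ((ecost e).+1 + N * K.+1).
Proof.
move=> eN I0 step; have := ends_for (f := fun=> K) eN I0 step.
by rewrite sum_nat_const card_ord.
Qed.

(** * Counting sort *)

Section CountingSort.
Variables (n : nat) (d : nat -> nat) (off : nat -> nat).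
Hypothesis off_step : forall v, v < n -> off (v + 1) = off v + d v.
Hypothesis d_lt : forall v, v < n -> d v < n.

Definition degree_count (i k : nat) : nat := count (fun v => d v == k) (iota 0 i).

#[local] Arguments degree_count : simpl never.

Definition bucket_start (k : nat) : nat := \sum_(j < k) degree_count n j.

Definition position (v : nat) : nat :=
  bucket_start (d v) + degree_count v (d v).

Lemma degree_countS i k : degree_count i.+1 k = degree_count i k + (d i == k).
Proof. by rewrite /degree_count -addn1 iotaD count_cat /= addn0. Qed.

Lemma degree_count_mono i j k : i <= j -> degree_count i k <= degree_count j k.
Proof. by move=> ij; rewrite -(subnKC ij) /degree_count iotaD count_cat leq_addr. Qed.

(** Within one degree class, the count strictly increases once [u] itself has been counted. For
    different degrees, [position u] stays inside the bucket of [d u], which ends where the next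
    bucket starts. *)
Lemma position_lt u v : u < n ->
  (d u < d v) || (d u == d v) && (u < v) -> position u < position v.
Proof.
move=> un /orP[ltd|/andP[/eqP eqd ltuv]]; last first.
  rewrite /position eqd ltn_add2l -eqd.
  apply: leq_trans (degree_count_mono (d u) ltuv).
  by rewrite degree_countS eqxx addn1.
have lt1 : position u < bucket_start (d u).+1.
  rewrite /bucket_start big_ord_recr /= /position ltn_add2l.
  apply: leq_trans (degree_count_mono (d u) un).
  by rewrite degree_countS eqxx addn1.
apply: leq_trans lt1 (leq_trans _ (leq_addr _ _)).
rewrite /bucket_start -(subnKC ltd) big_split_ord /=.
exact: leq_addr.
Qed.

Lemma position_inj u v : u < n -> v < n -> position u = position v -> u = v.
Proof.
move=> un vn e; case: (ltngtP (d u) (d v)) => h.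
- by have := position_lt (v := v) un; rewrite h e ltnn => /(_ isT).
- by have := position_lt (v := u) vn; rewrite h e ltnn => /(_ isT).
- case: (ltngtP u v) => // h'.
  + by have := position_lt (v := v) un; rewrite h eqxx h' orbT e ltnn => /(_ isT).
  + by have := position_lt (v := u) vn; rewrite h eqxx h' orbT e ltnn => /(_ isT).
Qed.

Lemma position_mono u v : u < n -> d u < d v -> position u < position v.
Proof. by move=> un ltd; apply: position_lt => //; rewrite ltd. Qed.

Lemma SortByDegree_ends s : regs s rN = n -> arrs s aOff = off ->
  ends SortByDegree s
    (fun s' => forall v, v < n -> arrs s' aPos v = position v)
    (1000 * n + 1000).
Proof.
move=> sN sO.
have dE s' i : arrs s' aOff = off -> i < n ->
    arrs s' aOff (i + 1) - arrs s' aOff i = d i.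
  by move=> -> lt_in; rewrite off_step // addKn.
(* The exact budget is left open while the phases are composed; its comparison with the stated bound
   is shelved to the end. *)
apply: ends_weaken (fun _ _ h => h) _; last shelve.
apply: ends_seq.
  apply: (ends_for_const (I := fun i s' => forall j, j < i -> arrs s' aCnt j = 0) (K := 100) (N := n)) => //.
  move=> i s' lt_in _ Ii; split => //= j; rewrite ltnS leq_eqVlt.
  by case: eqP => //= _; apply: Ii.
move=> s1 [F1a F1r] I1.
apply: ends_seq.
  apply: (ends_for_const (I := fun i s' => forall j, j < n -> arrs s' aCnt j = degree_count i j) (K := 100) (N := n)) => //=.
    by rewrite F1r.
  move=> i s' lt_in [Fa _] Ii; split => //= j ltj.
  have Eo : arrs s' aOff = off by rewrite Fa // F1a.
  rewrite dE // degree_countS.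
  case: eqP => [->|ne]; first by rewrite Ii ?d_lt ?eqxx.
  by rewrite Ii // [d i == j]eq_sym; case: eqP => // _; rewrite addn0.
move=> s2 [F2a F2r] I2.
apply: (ends_seq (Q1 := fun s' => regs s' rP = 0) (T1 := 2)); first by split.
move=> s3 [F3a F3r] I3.
apply: ends_seq.
  apply: (ends_for_const (I := fun i s' => regs s' rP = bucket_start i /\
      forall j, j < i -> arrs s' aBucket j = bucket_start j) (K := 100) (N := n)) => //=.
  - by rewrite F3r // F2r // F1r.
  - by rewrite I3 /bucket_start big_ord0.
  move=> i s' lt_in [Fa _] [IP IB]; split => //=; split.
    by rewrite IP Fa // F3a // I2 // /bucket_start big_ord_recr.
  by move=> j; rewrite ltnS leq_eqVlt; case: eqP => [->|_] //= /IB.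
move=> s4 [F4a F4r] [_ I4].
apply: ends_weaken; last exact: leqnn.
  (* [aBucket[k]] is the next free position of bucket [k]: its start plus the number of vertices of
     degree [k] placed so far. Hence [v] receives exactly [position v]. *)
  apply: (ends_for_const (I := fun i s' =>
    (forall k, k < n -> arrs s' aBucket k = bucket_start k + degree_count i k) /\
    forall v, v < i -> arrs s' aPos v = position v) (K := 100) (N := n)) => //=.
  - by rewrite F4r // F3r // F2r // F1r.
  - by split => // k lt_k; rewrite I4 // /degree_count /= addn0.
  move=> i s' lt_in [Fa _] [IB IP].
  have Eo : arrs s' aOff = off by rewrite Fa // F4a // F3a // F2a // F1a.
  split => //=; split.
    move=> k lt_k; rewrite dE // degree_countS addnA.
    case: eqP => [->|ne]; first by rewrite IB ?d_lt ?eqxx.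
    by rewrite IB // [d i == k]eq_sym; case: eqP => // _; rewrite addn0.
  move=> v; rewrite ltnS leq_eqVlt; case: eqP => [->|_] //= lt_v; last exact: IP.
  by rewrite dE // IB ?d_lt.
by move=> s' _ [].
Unshelve.
move=> /=; lia.
Qed.

End CountingSort.

(** * Orientation *)

Section Adjacency.
Variables (n : nat) (d off adj pos : nat -> nat).
Hypothesis off_step : forall v, v < n -> off (v + 1) = off v + d v.

Lemma off_mono u v : u <= v -> v <= n -> off u <= off v.
Proof.
move=> uv; rewrite -(subnKC uv); elim: (v - u) => [|k IH] h; first by rewrite addn0.
by rewrite addnS -addn1 off_step; lia.
Qed.

(** The blocks allotted to different vertices are disjoint: the earlier block ends no later than the
    other one begins. *)
Lemma off_inj v w i j : v < n -> w < n -> i < d v -> j < d w ->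
  off v + i = off w + j -> v = w.
Proof.
move=> vn wn iv jw e.
have sv := off_step vn; have sw := off_step wn.
case: (ltngtP v w) => // h.
- by have := off_mono (u := v + 1) (v := w); lia.
- by have := off_mono (u := w + 1) (v := v); lia.
Qed.

(** A family of lists stored in one array, cut into the same blocks as the input. The size bound
    keeps each list inside its block; the cells behind it are arbitrary. *)
Definition rep (A N : nat -> nat) (L : nat -> seq nat) : Prop :=
  forall v, v < n -> [/\ N v = size (L v), size (L v) <= d v
    & forall k, k < size (L v) -> A (off v + k) = nth 0 (L v) k].

(** The write hits the first free cell of the block of [v]; by [off_inj] it misses the stored
    entries of every other vertex. *)
Lemma rep_push A N L L' v x : rep A N L -> v < n -> size (L v) < d v ->
  (forall w, L' w = if w == v then rcons (L v) x else L w) ->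
  rep (fun j => if j == off v + N v then x else A j)
      (fun w => if w == v then N v + 1 else N w) L'.
Proof.
move=> H vn szv EL w wn; rewrite EL.
case: (H v vn) => Nv _ Av; case: (H w wn) => Nw szw Aw.
case: eqP => [->|ne]; split => //.
- by rewrite size_rcons Nv addn1.
- by rewrite size_rcons.
- move=> k; rewrite size_rcons ltnS nth_rcons eqn_add2l Nv leq_eqVlt.
  by case: eqP => [->|_] /=; [rewrite ltnn | move=> lk; rewrite lk Av].
- move=> k lk; case: eqP => [e|_]; last exact: Aw.
  by case: ne; apply: (off_inj wn vn _ _ e); lia.
Qed.

Definition nbrs (v : nat) : seq nat := [seq adj (off v + k) | k <- iota 0 (d v)].

(** Ghost state of [Orient]: the arcs found so far at [v] when its first [k] neighbours have been
    scanned, in the order in which the program meets them. *)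
Definition arcs_of (v k : nat) : seq (nat * nat) :=
  [seq (v, u) | u <- take k (nbrs v) & pos v < pos u].

Definition arcs (v : nat) : seq (nat * nat) :=
  flatten [seq arcs_of w (d w) | w <- iota 0 v].

Definition outs (P : seq (nat * nat)) (v : nat) : seq nat :=
  [seq p.2 | p <- P & p.1 == v].

Definition ins (P : seq (nat * nat)) (v : nat) : seq nat :=
  [seq p.1 | p <- P & p.2 == v].

Lemma mem_outs P v u : (u \in outs P v) = ((v, u) \in P).
Proof.
apply/mapP/idP => [[[a b]]|h]; last by exists (v, u); rewrite // mem_filter eqxx.
by rewrite mem_filter => /andP[/eqP /= -> ?] ->.
Qed.

Lemma mem_ins P v u : (u \in ins P v) = ((u, v) \in P).
Proof.
apply/mapP/idP => [[[a b]]|h]; last by exists (u, v); rewrite // mem_filter eqxx.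
by rewrite mem_filter => /andP[/eqP /= -> ?] ->.
Qed.

Lemma outs_uniq P v : uniq P -> uniq (outs P v).
Proof.
move=> uP; rewrite map_inj_in_uniq ?filter_uniq // => [[a b] [a' b']].
by rewrite !mem_filter /= => /andP[/eqP-> _] /andP[/eqP-> _] ->.
Qed.

Lemma ins_uniq P v : uniq P -> uniq (ins P v).
Proof.
move=> uP; rewrite map_inj_in_uniq ?filter_uniq // => [[a b] [a' b']].
by rewrite !mem_filter /= => /andP[/eqP-> _] /andP[/eqP-> _] ->.
Qed.

Lemma outs_cat P Q v : outs (P ++ Q) v = outs P v ++ outs Q v.
Proof. by rewrite /outs filter_cat map_cat. Qed.

Lemma ins_cat P Q v : ins (P ++ Q) v = ins P v ++ ins Q v.
Proof. by rewrite /ins filter_cat map_cat. Qed.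

Hypothesis nbrs_uniq : forall v, v < n -> uniq (nbrs v).
Hypothesis nbrs_lt : forall v u, v < n -> u \in nbrs v -> u < n.
Hypothesis nbrs_sym : forall v u, v < n -> u < n -> (u \in nbrs v) = (v \in nbrs u).

Lemma size_nbrs v : size (nbrs v) = d v.
Proof. by rewrite size_map size_iota. Qed.

Lemma nth_nbrs v k : k < d v -> nth 0 (nbrs v) k = adj (off v + k).
Proof. by move=> lk; rewrite (nth_map 0) ?size_iota // nth_iota. Qed.

Lemma arcsS v : arcs v.+1 = arcs v ++ arcs_of v (d v).
Proof. by rewrite /arcs -addn1 iotaD map_cat flatten_cat /= cats0. Qed.

Lemma mem_arcs_of v w u :
  ((w, u) \in arcs_of v (d v)) = [&& w == v, u \in nbrs v & pos v < pos u].
Proof.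
rewrite /arcs_of -size_nbrs take_size.
apply/mapP/and3P => [[u' h [-> ->]]|[/eqP -> h1 h2]].
  by rewrite mem_filter in h; case/andP: h.
by exists u; rewrite // mem_filter h1 h2.
Qed.

Lemma mem_arcs v w u :
  ((w, u) \in arcs v) = [&& w < v, u \in nbrs w & pos w < pos u].
Proof.
elim: v => [|v IH] //; rewrite arcsS mem_cat IH mem_arcs_of ltnS [w <= v]leq_eqVlt.
by case: eqP => [->|_] /=; rewrite ?ltnn ?orbF.
Qed.

Lemma arcs_uniq v : v <= n -> uniq (arcs v).
Proof.
elim: v => [|v IH] // lt_vn; rewrite arcsS cat_uniq IH ?(ltnW lt_vn) //=.
apply/andP; split.
  apply/hasPn => [[w u]]; rewrite mem_arcs_of mem_arcs => /and3P[/eqP -> _ _].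
  by rewrite ltnn.
rewrite map_inj_uniq => [|x y [] //].
by rewrite filter_uniq // take_uniq // nbrs_uniq.
Qed.

(* [Orient] has seen a prefix of the final list of arcs at any time, so the lists
   it builds never outgrow the cells allotted to a vertex. *)
Lemma arcs_prefix v k : v < n ->
  exists R, arcs n = (arcs v ++ arcs_of v k) ++ R.
Proof.
move=> lt_vn.
have [R1 E1] : exists R1, arcs n = arcs v.+1 ++ R1.
  rewrite /arcs -(subnKC lt_vn) iotaD map_cat flatten_cat.
  by eexists.
have [R2 E2] : exists R2, arcs_of v (d v) = arcs_of v k ++ R2.
  rewrite /arcs_of -size_nbrs take_size -{1}(cat_take_drop k (nbrs v)).
  by rewrite filter_cat map_cat; eexists.
by exists (R2 ++ R1); rewrite E1 arcsS E2 !catA.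
Qed.

Lemma outs_size v : v < n -> size (outs (arcs n) v) <= d v.
Proof.
move=> lt_vn; rewrite -size_nbrs uniq_leq_size ?outs_uniq ?arcs_uniq //.
by move=> u; rewrite mem_outs mem_arcs => /and3P[].
Qed.

Lemma ins_size v : v < n -> size (ins (arcs n) v) <= d v.
Proof.
move=> lt_vn; rewrite -size_nbrs uniq_leq_size ?ins_uniq ?arcs_uniq //.
move=> u; rewrite mem_ins mem_arcs => /and3P[un h _].
by rewrite -nbrs_sym.
Qed.

Lemma arcs_of_step v k : k < d v -> arcs_of v k.+1 =
  if pos v < pos (adj (off v + k)) then rcons (arcs_of v k) (v, adj (off v + k))
  else arcs_of v k.
Proof.
move=> lk; rewrite /arcs_of (take_nth 0) ?size_nbrs // nth_nbrs //.
by rewrite filter_rcons; case: ifP; rewrite ?map_rcons.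
Qed.

Lemma Orient_ends s : regs s rN = n -> arrs s aOff = off -> arrs s aAdj = adj ->
  (forall v, v < n -> arrs s aPos v = pos v) ->
  ends Orient s
    (fun s' => rep (arrs s' aOut) (arrs s' aOutN) (outs (arcs n)) /\
               rep (arrs s' aIn) (arrs s' aInN) (ins (arcs n)))
    (1000 * n + 1000 + \sum_(v < n) 100 * d v).
Proof.
move=> sN sO sA sP.
apply: ends_weaken (fun _ _ h => h) _; last shelve.
apply: ends_seq.
  apply: (ends_for_const (I := fun i s' => forall j, j < i ->
    arrs s' aOutN j = 0 /\ arrs s' aInN j = 0) (K := 100) (N := n)) => //.
  move=> i s' lt_in _ Ii; split => //= j; rewrite ltnS leq_eqVlt.
  by case: eqP => //= _; apply: Ii.
move=> s1 [F1a F1r] I1.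
pose J P s' := rep (arrs s' aOut) (arrs s' aOutN) (outs P) /\
               rep (arrs s' aIn) (arrs s' aInN) (ins P).
(* Both pairs of arrays are described by a single list of arcs, read by tail for [aOut] and by head
   for [aIn]; one arc found is one push into each. *)
apply: (ends_for (I := fun v s' => J (arcs v) s') (f := fun v => 100 + 60 * d v) (N := n)).
- by rewrite /= F1r.
- by split=> v lt_v; case: (I1 v lt_v) => e1 e2; rewrite /= ?e1 ?e2.
move=> v s2 lt_vn [F2a F2r] Jv.
apply: ends_weaken; first (apply: (ends_for_const
   (I := fun k s' => J (arcs v ++ arcs_of v k) s') (K := 50) (N := d v)) => /=).
- by rewrite !F2a // !F1a // sO off_step // addKn.
- by rewrite /arcs_of take0 cats0.
- move=> k s3 lt_k [F3a F3r] Jk.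
  have Eo : arrs s3 aOff = off by rewrite F3a //= F2a // F1a.
  have Ea : arrs s3 aAdj = adj by rewrite F3a //= F2a // F1a.
  have EP w : w < n -> arrs s3 aPos w = pos w.
    by move=> wn; rewrite F3a //= F2a // F1a // sP.
  have Ev : regs s3 rV = v by rewrite F3r.
  have un : adj (off v + k) < n.
    by apply: (nbrs_lt lt_vn); rewrite -nth_nbrs // mem_nth ?size_nbrs.
  rewrite arcs_of_step //.
  rewrite /ends /= Eo Ea Ev !EP //.
  have [R ER] := arcs_prefix k.+1 lt_vn.
  move: ER; rewrite arcs_of_step //.
  set u := adj _ in un *; case: ltnP => /= ltp ER; last by split.
  case: Jk => JO JI; move: JO JI; set P := _ ++ arcs_of v k => JO JI.
  have EP' : arcs v ++ rcons (arcs_of v k) (v, u) = rcons P (v, u).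
    by rewrite -rcons_cat.
  rewrite EP' in ER *; split=> //; split.
  (* There is room: the final list at [v] has at most [d v] entries and contains the current list
     together with the new arc, so the current one is strictly shorter. *)
  + apply: (rep_push JO lt_vn).
      have := outs_size lt_vn; rewrite ER -cats1 !outs_cat !size_cat /outs /= eqxx /=.
      by lia.
    move=> w; rewrite -cats1 outs_cat /outs /= [v == w]eq_sym.
    by case: eqP => [->|_] /=; rewrite ?cats1 ?cats0.
  + apply: (rep_push JI un).
      have := ins_size un; rewrite ER -cats1 !ins_cat !size_cat /ins /= eqxx /=.
      by lia.
    move=> w; rewrite -cats1 ins_cat /ins /= [u == w]eq_sym.
    by case: eqP => [->|_] /=; rewrite ?cats1 ?cats0.
- by move=> s' _; rewrite arcsS.
- by rewrite /=; lia.
Unshelve.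
rewrite /=.
have -> : \sum_(i < n) (100 + 60 * d i).+1 = 101 * n + \sum_(i < n) 60 * d i.
  rewrite -[101 * n]mulnC -[n in n * 101]card_ord -sum_nat_const -big_split /=.
  by apply: eq_bigr => i _; lia.
have : \sum_(i < n) 60 * d i <= \sum_(i < n) 100 * d i.
  by apply: leq_sum => i _; lia.
move: (\sum_(i < n) _) (\sum_(i < n) _) => a b; lia.
Qed.

End Adjacency.

(** * Counting phase *)

Lemma sum_nat_affine (n a b : nat) (f : nat -> nat) :
  \sum_(i < n) (a + b * f i).+1 = n * a.+1 + b * \sum_(i < n) f i.
Proof.
rewrite big_distrr /= -[n in n * _]card_ord -sum_nat_const -big_split /=.
by apply: eq_bigr => i _; rewrite addSn.
Qed.

Section Counting.
Variables (n : nat) (d off : nat -> nat) (out inn : nat -> seq nat).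
Hypothesis out_lt : forall v u, v < n -> u \in out v -> u < n.
Hypothesis inn_lt : forall v u, v < n -> u \in inn v -> u < n.

Lemma SetS_ends b s v : v < n -> regs s rV = v -> arrs s aOff = off ->
  rep n d off (arrs s aOut) (arrs s aOutN) out ->
  ends (SetS b) s
    (fun s' => forall j, arrs s' aS j = if j \in out v then b else arrs s aS j)
    (10 + 20 * size (out v)).
Proof.
move=> lt_vn sV sO sR; case: (sR v lt_vn) => eN _ eA.
apply: ends_weaken; first (apply: (ends_for_const (I := fun k s' => forall j,
   arrs s' aS j = if j \in take k (out v) then b else arrs s aS j)
   (K := 15) (N := size (out v)))).
- by rewrite /= sV.
- by move=> j; rewrite take0.
- move=> k s' lt_k [Fa Fr] Ik; split=> // j /=.
  rewrite (Fa aOff) // (Fa aOut) // (Fr rV) // sV sO eA // (take_nth 0) //.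
  by rewrite mem_rcons in_cons Ik; case: eqP.
- by move=> s' _; rewrite take_size.
- by rewrite /=; lia.
Qed.

(** The number of increments caused by the in-edge from [w] to [v]. *)
Definition hits (v w : nat) : nat := \sum_(u <- out w) (u \in out v).

(** The code after [SortByDegree] and [Orient], extracted by matching instead of being copied; the
    [else] branch is never reached. *)
Definition count_phase : cmd :=
  if CountTriangles is Seq _ (Seq _ c) then c else CountTriangles.

(** Setting and clearing [aS] costs the out-degree of [v], and each in-edge from [w] costs a
    constant plus the out-degree of [w]. *)
Lemma count_phase_ends s : regs s rN = n -> arrs s aOff = off ->
  rep n d off (arrs s aOut) (arrs s aOutN) out ->
  rep n d off (arrs s aIn) (arrs s aInN) inn ->
  ends count_phase s
    (fun s' => regs s' rCount = \sum_(v < n) \sum_(w <- inn v) hits v w)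
    (1000 * n + 1000 + 100 * \sum_(v < n)
       (size (out v) + size (inn v) + \sum_(w <- inn v) size (out w))).
Proof.
move=> sN sO sR sI; rewrite /count_phase /=.
apply: ends_weaken (fun _ _ h => h) _; last shelve.
apply: (ends_seq (Q1 := fun s' => regs s' rCount = 0) (T1 := 2)); first by split.
move=> s1 [F1a F1r] C1.
apply: ends_seq.
  apply: (ends_for_const (I := fun i s' => forall j, j < i -> arrs s' aS j = 0)
    (K := 50) (N := n)) => //=; first by rewrite F1r.
  move=> i s' lt_in _ Ii; split => //= j; rewrite ltnS leq_eqVlt.
  by case: eqP => //= _; apply: Ii.
move=> s2 [F2a F2r] I2.
apply: ends_weaken; last exact: leqnn.
  (* Between iterations [aS] is zero again below [n]: [SetS 0] erases precisely the entries that
     [SetS 1] marked, in time independent of [n]. *)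
  apply: (ends_for (I := fun v s' => (forall j, j < n -> arrs s' aS j = 0) /\
     regs s' rCount = \sum_(i < v) \sum_(w <- inn i) hits i w)
    (f := fun v => 150 + 100 * (size (out v) + size (inn v)
                   + \sum_(w <- inn v) size (out w))) (N := n)).
  - by rewrite /= F2r // F1r.
  - by split=> //; rewrite F2r // C1 big_ord0.
  move=> v s3 lt_vn [F3a F3r] [S3 C3].
  have O3 : arrs s3 aOff = off by rewrite F3a // F2a // F1a.
  have R3 : rep n d off (arrs s3 aOut) (arrs s3 aOutN) out.
    by rewrite !F3a // !F2a // !F1a.
  have J3 : rep n d off (arrs s3 aIn) (arrs s3 aInN) inn.
    by rewrite !F3a // !F2a // !F1a.
  apply: ends_weaken (fun _ _ h => h) _; last shelve.
  apply: ends_seq; first by apply: (SetS_ends _ lt_vn) => //.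
  move=> s4 [F4a F4r] /= S4.
  have {}S4 j : j < n -> arrs s4 aS j = (j \in out v).
    by move=> jn; rewrite S4 /= S3 //; case: ifP.
  have V4 : regs s4 rV = v by rewrite F4r.
  have O4 : arrs s4 aOff = off by rewrite F4a.
  have R4 : rep n d off (arrs s4 aOut) (arrs s4 aOutN) out by rewrite !F4a.
  have J4 : rep n d off (arrs s4 aIn) (arrs s4 aInN) inn by rewrite !F4a.
  have C4 : regs s4 rCount = \sum_(i < v) \sum_(w <- inn i) hits i w by rewrite F4r.
  set c4 := regs s4 rCount in C4.
  case: (J4 v lt_vn) => szI _ nthI.
  apply: (ends_seq (Q1 := fun s' => regs s' rCount =
      \sum_(i < v.+1) \sum_(w <- inn i) hits i w)).
    apply: ends_weaken; last exact: leqnn.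
      apply: (ends_for (I := fun j s' => regs s' rCount =
        c4 + \sum_(w <- take j (inn v)) hits v w)
        (f := fun j => 40 + 30 * size (out (nth 0 (inn v) j))) (N := size (inn v))).
      - by rewrite /= V4 szI.
      - by rewrite take0 big_nil addn0.
      move=> j s5 lt_j [F5a F5r] C5.
      have lt_w : nth 0 (inn v) j < n by apply: (inn_lt lt_vn); rewrite mem_nth.
      set w := nth 0 (inn v) j in lt_w *.
      case: (R4 w lt_w) => szO _ nthO.
      apply: ends_weaken (fun _ _ h => h) _; last shelve.
      apply: (ends_seq (Q1 := fun s' => regs s' rW = w) (T1 := 6)).
        by split => //=; rewrite !F5a //= F5r //= V4 O4 nthI.
      move=> s6 [F6a F6r] W6.
      apply: ends_weaken; last exact: leqnn.
        apply: (ends_for_const (I := fun k s' => regs s' rCount =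
          regs s6 rCount + \sum_(u <- take k (out w)) (u \in out v))
          (K := 20) (N := size (out w))).
        - by rewrite /= W6 F6a //= F5a.
        - by rewrite take0 big_nil addn0.
        move=> k s7 lt_k [F7a F7r] C7.
        have lt_u : nth 0 (out w) k < n by apply: (out_lt lt_w); rewrite mem_nth.
        rewrite (take_nth 0) // -cats1 big_cat big_seq1 addnA -C7.
        have Ou : arrs s7 aOut (arrs s7 aOff (regs s7 rW) + k) = nth 0 (out w) k.
          by rewrite !F7a // !F6a //= !F5a // F7r // W6 O4 nthO.
        rewrite /ends /= Ou (F7a aS) // (F6a aS) //= (F5a aS) // S4 //.
        by case: (_ \in _) => /=; rewrite ?addn0.
      move=> s' _ ->; rewrite take_size F6r //= C5.
      by rewrite (take_nth 0) // -cats1 big_cat big_seq1 addnA.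
    by move=> s' _ ->; rewrite take_size big_ord_recr /= C4.
  move=> s8 [F8a F8r] C8.
  apply: ends_weaken; last exact: leqnn.
    apply: (SetS_ends _ lt_vn) => //.
    + by rewrite F8r.
    + by rewrite F8a.
    + by rewrite !F8a.
  move=> s9 [F9a F9r] S9; split; last by rewrite F9r.
  by move=> j jn; rewrite S9; case: ifP => // jO; rewrite F8a // S4 // jO.
by move=> s' _ [].
Unshelve.
- rewrite /= (sum_nat_affine n 150 100 (fun i => size (out i) + size (inn i)
     + \sum_(w <- inn i) size (out w))).
  by move: (\sum_(i < n) _) => a; lia.
- rewrite /= (sum_nat_affine _ 40 30 (fun i => size (out (nth 0 (inn v) i)))).
  (* The budget indexed by list positions is turned into a sum over the entries of [inn v]. *)
  rewrite -(big_mkord xpredT (fun i => size (out (nth 0 (inn v) i)))).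
  rewrite -(big_nth 0 xpredT (fun w => size (out w))).
  by move: (\sum_(w <- _) _) => a; lia.
- by rewrite /=; lia.
Qed.

End Counting.

(** * Triangles and out-degrees *)

Section Orientation.
Variables (n : nat) (G : sgraph n) (pos : 'I_n -> nat).

Lemma deg_lt v : deg G v < n.
Proof.
rewrite -[n in X in _ < X]card_ord -cardsT; apply: proper_card; apply/properP.
by split; [apply: finset.subsetT|exists v; rewrite // inE edge_irr].
Qed.

Definition arc : rel 'I_n := fun u v => edge G u v && (pos u < pos v).

Definition outdeg (v : 'I_n) : nat := #|[set u | arc v u]|.

Hypothesis pos_inj : injective pos.

(** Double counting of arcs: [w] is met once for every arc leaving it. With [F] the out-degree, this
    produces the sum of squares. *)
Lemma sum_arc_swap (F : 'I_n -> nat) :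
  \sum_v \sum_(w | arc w v) F w = \sum_w outdeg w * F w.
Proof.
rewrite (exchange_big_dep xpredT) //=; apply: eq_bigr => w _.
by rewrite sum_nat_cond_const /outdeg cardsE.
Qed.

Lemma sum_indeg : \sum_v #|[set w | arc w v]| = \sum_v outdeg v.
Proof.
rewrite (eq_bigr (fun v => \sum_(w | arc w v) 1)) => [|v _].
  by rewrite sum_arc_swap; apply: eq_bigr => w _; rewrite muln1.
by rewrite sum1_card cardsE.
Qed.

(** Injectivity of [pos] orients each edge at [v] in exactly one way. *)
Lemma deg_split v : deg G v = outdeg v + #|[set w | arc w v]|.
Proof.
rewrite /deg -cardsUI [X in _ + X](_ : _ = 0) ?addn0.
  apply: eq_card => u; rewrite !inE /arc (edge_sym G u v) -andb_orr.
  case: (ltngtP (pos v) (pos u)) => h; rewrite ?andbT // (pos_inj h).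
  by rewrite edge_irr.
by apply: eq_card0 => u; rewrite !inE /arc; lia.
Qed.

(** The sum counts triples [(w, v, u)] with increasing positions and all three arcs; sending a
    triple to its vertex set is a bijection onto the triangles. *)
Lemma triangle_count :
  \sum_v \sum_(w | arc w v) \sum_(u | arc w u) arc v u = #|triangles G|.
Proof.
pose tri (p : 'I_n * 'I_n * 'I_n) := [&& arc p.1.1 p.1.2, arc p.1.2 p.2 & arc p.1.1 p.2].
transitivity #|[set p | tri p]|.
  rewrite cardsE -sum1_card.
  rewrite (eq_bigl (fun p : 'I_n * 'I_n * 'I_n => true && tri p)) //.
  rewrite big_mkcondr -(pair_bigA _ (fun p u => if tri (p, u) then 1 else 0)) /=.
  rewrite -(pair_bigA _ (fun w v => \sum_u if tri (w, v, u) then 1 else 0)) /=.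
  rewrite [RHS]exchange_big /=; apply: eq_bigr => v _.
  rewrite [LHS]big_mkcond /=; apply: eq_bigr => w _.
  rewrite /tri /=; case: (arc w v) => /=; last by rewrite big1.
  rewrite [LHS]big_mkcond /=; apply: eq_bigr => u _.
  by case: (arc w u); case: (arc v u).
pose f (p : 'I_n * 'I_n * 'I_n) := [set p.1.1; p.1.2; p.2].
(* Injectivity: equal vertex sets occupy equal sets of positions, and an increasing triple is
   determined by its set. *)
rewrite -(card_in_imset (f := f)); last first.
  move=> [[w v] u] [[w' v'] u']; rewrite !inE /tri /= => /and3P[] /andP[_ l1] /andP[_ l2] _.
  move=> /and3P[] /andP[_ l1'] /andP[_ l2'] _ e.
  have H x : (x \in f (w, v, u)) = (x \in f (w', v', u')) by rewrite e.
  have pE (x y : 'I_n) : (x == y) = (pos x == pos y) by rewrite (inj_eq pos_inj).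
  have := (H w, H v, H u); have := (H w', H v', H u').
  rewrite !inE !pE !eqxx ?orbT /= => [[[h1 h2] h3] [[h4 h5] h6]].
  have [e1 e2 e3] : [/\ pos w = pos w', pos v = pos v' & pos u = pos u'] by split; lia.
  by rewrite (pos_inj e1) (pos_inj e2) (pos_inj e3).
apply: eq_card => A; rewrite inE; apply/imsetP/andP.
- move=> [[[w v] u]]; rewrite inE => /and3P[] /andP[/= e1 l1] /andP[/= e2 l2] /andP[/= e3 l3] ->.
  have nw : w != v by rewrite -(inj_eq pos_inj); lia.
  have nv : v != u by rewrite -(inj_eq pos_inj); lia.
  have nu : w != u by rewrite -(inj_eq pos_inj); lia.
  split.
    by rewrite /f /= finset.setUC cardsU1 !inE negb_or cards2 nw ![u == _]eq_sym nv nu.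
  apply/forallP => x; apply/implyP; rewrite !inE /= => hx.
  apply/forallP => y; apply/implyP; rewrite !inE /= => hy.
  apply/implyP; move: hx hy.
  by case/orP => [/orP[]|] /eqP ->; case/orP => [/orP[]|] /eqP ->; rewrite ?eqxx //= ?e1 ?e2 ?e3 //
    edge_sym ?e1 ?e2 ?e3.
- case=> /eqP cA /forallP hA.
  have E x y : x \in A -> y \in A -> pos x < pos y -> arc x y.
    move=> xA yA lt; move: (hA x); rewrite xA => /forallP /(_ y); rewrite yA /=.
    by rewrite -(inj_eq pos_inj) /arc lt andbT neq_ltn lt.
  (* Surjectivity: sorting the three vertices of a triangle by position gives the preimage. *)
  pose s := sort (fun x y => pos x <= pos y) (enum A).
  have sz : size s = 3 by rewrite size_sort -cardE.
  have us : uniq s by rewrite sort_uniq enum_uniq.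
  have ss : sorted (fun x y => pos x <= pos y) s.
    by apply: sort_sorted => x y; apply: leq_total.
  have ms x : (x \in s) = (x \in A) by rewrite mem_sort mem_enum.
  move: sz us ss ms; case: s => [|w [|v [|u []]]] // _.
  rewrite /= !inE negb_or !andbT -!(inj_eq pos_inj) => /andP[/andP[n1 n2] n3] /andP[l1 l2] ms.
  have [wA vA uA] : [/\ w \in A, v \in A & u \in A].
    by rewrite -!ms !inE !eqxx ?orbT.
  exists (w, v, u).
    by rewrite inE /tri /= !E //; lia.
  by apply/setP => x; rewrite -ms !inE orbA.
Qed.

End Orientation.

(** The order is hidden behind an existential: the later analysis only uses that it refines the
    order by degree. *)
Lemma CountTriangles_run n (G : sgraph n) s : encodes G s ->
  exists pos : 'I_n -> nat,
    [/\ injective pos,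
        forall u v, deg G u < deg G v -> pos u < pos v
      & ends CountTriangles s (fun s' => regs s' rCount = #|triangles G|)
          (3000 * n.+1 + 500 * \sum_v outdeg G pos v ^ 2)].
Proof.
case=> sN sO0 sO sA.
set off := arrs s aOff; set adj := arrs s aAdj.
pose d v := off (v + 1) - off v.
have dE (v : 'I_n) : d v = deg G v by rewrite /d addn1 /off sO addKn.
have off_step v : v < n -> off (v + 1) = off v + d v.
  by move=> vn; rewrite (dE (Ordinal vn)) addn1 /off (sO (Ordinal vn)).
have d_lt v : v < n -> d v < n by move=> vn; rewrite (dE (Ordinal vn)) deg_lt.
have nbrsE (v : 'I_n) : perm_eq (nbrs d off adj v)
    [seq val u | u <- enum [set u | edge G v u]] by rewrite /nbrs dE; apply: sA.
have mem_nbrs (v u : 'I_n) : (val u \in nbrs d off adj v) = edge G v u.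
  by rewrite (perm_mem (nbrsE v)) (mem_map val_inj) mem_enum inE.
have nbrs_uniq v : v < n -> uniq (nbrs d off adj v).
  move=> vn; rewrite (perm_uniq (nbrsE (Ordinal vn))) (map_inj_uniq val_inj).
  exact: enum_uniq.
have nbrs_lt v u : v < n -> u \in nbrs d off adj v -> u < n.
  by move=> vn; rewrite (perm_mem (nbrsE (Ordinal vn))) => /mapP[x _ ->]; apply: ltn_ord.
have nbrs_sym v u : v < n -> u < n ->
    (u \in nbrs d off adj v) = (v \in nbrs d off adj u).
  move=> vn un; have := mem_nbrs (Ordinal vn) (Ordinal un) => /= ->.
  by have := mem_nbrs (Ordinal un) (Ordinal vn) => /= ->; apply: edge_sym.
pose pos (v : 'I_n) := position n d v.
have pos_inj : injective pos.
  by move=> u v e; apply/val_inj/(position_inj (ltn_ord u) (ltn_ord v) e).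
exists pos; split => //.
  by move=> u v lt; apply: position_mono; rewrite ?dE ?ltn_ord.
(* The lists of natural numbers are now matched with the relation [arc] on ['I_n], up to
   permutation, which is enough for sums and sizes. *)
set A := arcs d off adj (position n d) n.
have memA (w u : 'I_n) : ((val w, val u) \in A) = arc G pos w u.
  by rewrite mem_arcs ltn_ord mem_nbrs.
have A_lt w u : (w, u) \in A -> w < n /\ u < n.
  rewrite mem_arcs => /and3P[wn h _]; split => //; exact: nbrs_lt h.
have uA : uniq A by apply: (arcs_uniq _ nbrs_uniq (leqnn n)).
have outsE (v : 'I_n) : perm_eq (outs A v) [seq val u | u <- enum (arc G pos v)].
  apply: uniq_perm; rewrite ?outs_uniq ?(map_inj_uniq val_inj) ?enum_uniq // => u.
  rewrite mem_outs; apply/idP/mapP => [h|[x]]; last first.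
    by rewrite mem_enum => h ->; rewrite memA.
  have [_ un] := A_lt _ _ h; exists (Ordinal un) => //.
  by rewrite mem_enum [_ \in _]/in_mem /= -memA.
have insE (v : 'I_n) : perm_eq (ins A v) [seq val u | u <- enum (arc G pos ^~ v)].
  apply: uniq_perm; rewrite ?ins_uniq ?(map_inj_uniq val_inj) ?enum_uniq // => u.
  rewrite mem_ins; apply/idP/mapP => [h|[x]]; last first.
    by rewrite mem_enum => h ->; rewrite memA.
  have [un _] := A_lt _ _ h; exists (Ordinal un) => //.
  by rewrite mem_enum [_ \in _]/in_mem /= -memA.
have sum_outs (v : 'I_n) F : \sum_(u <- outs A v) F u = \sum_(u | arc G pos v u) F (val u).
  by rewrite (perm_big _ (outsE v)) big_map big_enum.
have sum_ins (v : 'I_n) F : \sum_(u <- ins A v) F u = \sum_(u | arc G pos u v) F (val u).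
  by rewrite (perm_big _ (insE v)) big_map big_enum.
have size_outs (v : 'I_n) : size (outs A v) = outdeg G pos v.
  by rewrite (perm_size (outsE v)) size_map -cardE /outdeg cardsE.
have size_ins (v : 'I_n) : size (ins A v) = #|[set w | arc G pos w v]|.
  by rewrite (perm_size (insE v)) size_map -cardE cardsE.
apply: ends_weaken; first (apply: ends_seq).
- exact: (SortByDegree_ends off_step d_lt sN).
- move=> s1 [F1a F1r] P1.
  apply: ends_seq.
    by apply: (Orient_ends off_step nbrs_uniq nbrs_lt nbrs_sym _ _ _ P1);
      rewrite ?F1a ?F1r.
  move=> s2 [F2a F2r] [RO RI].
  apply: (count_phase_ends (n := n) (off := off) (d := d) (out := outs A) (inn := ins A)) => //.
  + by move=> v u _; rewrite mem_outs => h; case: (A_lt _ _ h).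
  + by move=> v u _; rewrite mem_ins => h; case: (A_lt _ _ h).
  + by rewrite F2r // F1r.
  + by rewrite F2a // F1a.
- move=> s' _ ->; rewrite -(triangle_count G pos_inj); apply: eq_bigr => v _.
  rewrite sum_ins; apply: eq_bigr => w _; rewrite /hits sum_outs.
  by apply: eq_bigr => u _; rewrite mem_outs memA.
- set S1 := \sum_(v < n) outdeg G pos v; set S2 := \sum_v _.
  (* All linear terms are absorbed, since [k <= k ^ 2] for natural [k]. [Orient] contributes
     [200 * S1] and the counting phase [200 * S1 + 100 * S2], whence the factor 500. *)
  have S12 : S1 <= S2 by apply: leq_sum => v _; rewrite -mulnn; nia.
  have -> : \sum_(v < n) 100 * d v = 100 * (S1 + S1).
    rewrite {2}/S1 -(sum_indeg G pos) -big_split big_distrr /=.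
    by apply: eq_bigr => v _; rewrite dE (deg_split G pos_inj).
  have -> : \sum_(v < n) (size (outs A v) + size (ins A v)
      + \sum_(w <- ins A v) size (outs A w)) = S1 + S1 + S2.
    rewrite !big_split /=; congr (_ + _ + _).
    + by apply: eq_bigr.
    + by rewrite /S1 -(sum_indeg G pos); apply: eq_bigr.
    + rewrite (eq_bigr (fun v : 'I_n => \sum_(w | arc G pos w v) outdeg G pos w)).
        by rewrite sum_arc_swap; apply: eq_bigr => w _; rewrite -mulnn.
      by move=> v _; rewrite sum_ins; apply: eq_bigr => w _; apply: size_outs.
  by lia.
Qed.

(** * Power law bounded graphs *)

Section Buckets.
Variables (n : nat) (G : sgraph n) (pos : 'I_n -> nat).
Hypothesis pos_mono : forall u v, deg G u < deg G v -> pos u < pos v.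

Definition bucket (e : nat) : nat :=
  #|[set v | (2 ^ e <= deg G v)%N && (deg G v < 2 ^ e.+1)%N]|.

Lemma outdeg_le_deg v : outdeg G pos v <= deg G v.
Proof. by apply: subset_leq_card; apply/fintype.subsetP => u; rewrite !inE => /andP[]. Qed.

(** Arcs never lead to a vertex of smaller degree, so all out-neighbours of [v] lie in the set on
    the right. *)
Lemma outdeg_le_card_deg_ge m v : m <= deg G v ->
  outdeg G pos v <= #|[set u | m <= deg G u]|.
Proof.
move=> le_m; apply: subset_leq_card; apply/fintype.subsetP => u; rewrite !inE => /andP[_ lt].
apply: leq_trans le_m _; rewrite leqNgt; apply/negP => /pos_mono.
by rewrite ltnNge (ltnW lt).
Qed.

Lemma sum_outdeg_low m :
  \sum_(v | deg G v < 2 ^ m) outdeg G pos v ^ 2 <= \sum_(e < m) 4 ^ e.+1 * bucket e.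
Proof.
elim: m => [|m IH].
  (* Vertices of degree 0 lie in no bucket, but they have out-degree 0. *)
  rewrite big1 // => v; rewrite ltnS leqn0 => /eqP d0.
  by have := outdeg_le_deg v; rewrite d0 leqn0 => /eqP ->.
rewrite big_ord_recr /= (bigID (fun v => deg G v < 2 ^ m)) /=.
apply: leq_add.
  apply: leq_trans IH; apply: eq_leq; apply: eq_bigl => v; apply/andP/idP => [[]|h] //.
  by split=> //; apply: leq_trans h _; rewrite leq_exp2l.
rewrite /bucket -sum1_card big_distrr /=.
apply: (@leq_trans (\sum_(v | (deg G v < 2 ^ m.+1) && ~~ (deg G v < 2 ^ m)) 4 ^ m.+1)).
  apply: leq_sum => v /andP[lt _].
  rewrite -[4]/(2 ^ 2) -expnM mulnC expnM leq_exp2r //.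
  exact: leq_trans (outdeg_le_deg v) (ltnW lt).
by apply: eq_leq; apply: eq_big => v; rewrite ?inE -?leqNgt 1?andbC ?muln1.
Qed.

(** Since degrees are below [n < 2 ^ n], the [n] buckets from scale [m] on reach every such
    vertex. *)
Lemma card_deg_ge m : #|[set v | 2 ^ m <= deg G v]| <= \sum_(e < n) bucket (m + e).
Proof.
suff H k : #|[set v | (2 ^ m <= deg G v) && (deg G v < 2 ^ (m + k))]|
    <= \sum_(e < k) bucket (m + e).
  apply: leq_trans (H n); apply: subset_leq_card; apply/fintype.subsetP => v.
  rewrite !inE => -> /=; apply: ltn_trans (deg_lt G v) _.
  by apply: leq_trans (ltn_expl n (isT : 1 < 2)) _; rewrite leq_exp2l // leq_addl.
elim: k => [|k IH].
  by rewrite big_ord0 leqn0 cards_eq0; apply/eqP/setP => v; rewrite !inE addn0 leqNgt andNb.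
rewrite big_ord_recr /=; apply: leq_trans (leq_add IH (leqnn _)).
apply: leq_trans (leq_card_setU _ _); apply: subset_leq_card.
by apply/fintype.subsetP => v; rewrite !inE addnS; lia.
Qed.

(** If [N] vertices have degree at least [2 ^ m], each of them has out-degree at most [N], so
    together they contribute at most [N ^ 3]. *)
Lemma sum_outdeg_split m : \sum_v outdeg G pos v ^ 2 <=
  \sum_(e < m) 4 ^ e.+1 * bucket e + (\sum_(e < n) bucket (m + e)) ^ 3.
Proof.
rewrite (bigID (fun v => deg G v < 2 ^ m)) /=; apply: leq_add (sum_outdeg_low m) _.
apply: leq_trans (_ : #|[set v | 2 ^ m <= deg G v]| ^ 3 <= _); last first.
  by rewrite leq_exp2r // card_deg_ge.
rewrite expnS -{1}sum1_card big_distrl /=.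
rewrite [leqRHS](eq_bigl (fun v => ~~ (deg G v < 2 ^ m))) => [|v]; last first.
  by rewrite inE -leqNgt.
apply: leq_sum => v; rewrite -leqNgt mul1n leq_exp2r //.
exact: outdeg_le_card_deg_ge.
Qed.

Lemma sum_outdeg_all m : n <= 2 ^ m ->
  \sum_v outdeg G pos v ^ 2 <= \sum_(e < m) 4 ^ e.+1 * bucket e.
Proof.
move=> le_n; apply: leq_trans (sum_outdeg_low m); apply: eq_leq; apply: eq_bigl => v.
by rewrite (leq_trans (deg_lt G v)).
Qed.

End Buckets.

Local Open Scope ring_scope.

(** * Real powers, geometric sums and the size of a bucket *)

Section Powers.
Variable R : realType.
Implicit Types x y r : R.

Lemma powR_anti x y r : 0 < x -> x <= y -> r <= 0 -> y `^ r <= x `^ r.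
Proof.
move=> x0 xy r0; rewrite -[r]opprK !(powRN _ (- r)).
have y0 := lt_le_trans x0 xy.
rewrite lef_pV2 ?posrE ?powR_gt0 //.
by apply: ge0_ler_powR; rewrite ?nnegrE ?oppr_ge0 // ltW.
Qed.

Lemma powR_pow2 e r : (2 ^ e)%:R `^ r = (2 `^ r) ^+ e :> R.
Proof.
by rewrite natrX -powR_mulrn // -powRrM mulrC powRrM powR_mulrn ?powR_ge0.
Qed.

Lemma powRD_gt0 x r s : 0 < x -> x `^ (r + s) = x `^ r * x `^ s.
Proof. by move=> x0; rewrite powRD // (gt_eqF x0) implybT. Qed.

(** Rounds a real threshold up to a bucket boundary at the price of a factor 2. *)
Lemma ge1_pow2 x : 1 <= x -> exists m, x < (2 ^ m)%:R /\ (2 ^ m)%:R <= 2 * x.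
Proof.
move=> x1; have x0 : 0 <= x := le_trans ler01 x1.
exists (trunc_log 2 (Num.trunc x)).+1.
have tr0 : (0 < Num.trunc x)%N by rewrite truncn_gt0.
have /andP[lo hi] := trunc_log_bounds (isT : (1 < 2)%N) tr0.
have /andP[xl xu] := truncn_itv x0.
split; first by apply: lt_le_trans xu _; rewrite ler_nat.
by rewrite expnS natrM ler_pM2l // (le_trans _ xl) // ler_nat.
Qed.

Lemma geometric_sum_ge q m : 1 < q :> R -> \sum_(e < m) q ^+ e <= q ^+ m / (q - 1).
Proof.
move=> q1; rewrite ler_pdivlMr ?subr_gt0 // mulrC -subrX1 lerBlDr lerDl ler01 //.
Qed.

Lemma geometric_sum_le p m : 0 < p :> R -> p < 1 -> \sum_(e < m) p ^+ e <= (1 - p)^-1.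
Proof.
move=> p0 p1; rewrite -[leRHS]mul1r ler_pdivlMr ?subr_gt0 // mulrC.
rewrite -opprB mulNr -subrX1 opprB lerBlDr lerDl exprn_ge0 // ltW //.
Qed.

(** Each of the [2 ^ e] summands of the PLB bound is at most its value with base [y]. The choice
    [y = 2 ^ e] suits large scales, [y = t + 1] small ones. *)
Lemma PLB_bucket c1 alpha t n (G : sgraph n) e y : 0 < c1 -> 0 <= alpha -> 0 <= t ->
  PLB c1 alpha t G -> 0 < y -> y <= (2 ^ e)%:R + t ->
  (bucket G e)%:R <= c1 * n%:R * (t + 1) `^ (alpha - 1) * ((2 ^ e)%:R * y `^ (- alpha)).
Proof.
move=> c0 a0 t0 H y0 ye; apply: le_trans (H e) _.
apply: ler_wpM2l; first by rewrite !mulr_ge0 ?powR_ge0 // ltW.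
apply: (@le_trans _ _ (\sum_(2 ^ e <= i < 2 ^ e.+1) y `^ (- alpha))).
  rewrite big_nat_cond [leRHS]big_nat_cond; apply: ler_sum => i /andP[/andP[le_i _] _].
  apply: powR_anti; rewrite ?oppr_le0 //.
  by apply: le_trans ye _; rewrite lerD2r ler_nat.
by rewrite sumr_const_nat expnS mul2n -addnn addnK mulr_natl.
Qed.

End Powers.

Lemma ler_of_eq (R : numDomainType) (x y : R) : x = y -> x <= y.
Proof. by move->. Qed.

(** * Sum of squared out-degrees for the three ranges of [alpha] *)

Section OutdegreeSquares.
Variables (R : realType) (c1 alpha : R).
Hypotheses (c1_gt0 : 0 < c1) (alpha_gt1 : 1 < alpha).

Lemma gt1_pow2 (r : R) : 0 < r -> 1 < 2 `^ r.
Proof.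
move=> r0; have := gt0_ltr_powR r0 (x := 1) (y := 2).
by rewrite powR1 !nnegrE ler01 ler0n ltr1n => ->.
Qed.

Lemma lt1_pow2 (r : R) : r < 0 -> 2 `^ r < 1.
Proof.
move=> r0; rewrite -[r]opprK powRN invf_lt1 ?powR_gt0 //.
by apply: gt1_pow2; rewrite oppr_gt0.
Qed.

Lemma le_log2 k m : (2 ^ k <= m)%N -> k%:R <= log2 (m%:R : R).
Proof.
move=> le_m; have m0 : (0 < m)%N by apply: leq_trans le_m; rewrite expn_gt0.
have ln2_gt0 : 0 < ln 2 :> R by rewrite ln_gt0 // ltr1n.
rewrite /log2 ler_pdivlMr // mulr_natl -lnXn ?ltr0n //.
by rewrite ler_ln ?posrE ?exprn_gt0 ?ltr0n // -natrX ler_nat.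
Qed.

Let alpha_gt0 : 0 < alpha. Proof. exact: lt_trans ltr01 alpha_gt1. Qed.

Variables (n : nat) (G : sgraph n) (t : R).
Hypotheses (t_ge0 : 0 <= t) (GPLB : PLB c1 alpha t G).

Let T := t + 1.
Let kappa := c1 * n%:R * T `^ (alpha - 1).

Let T_ge1 : 1 <= T. Proof. by rewrite /T lerDr. Qed.
Let T_gt0 : 0 < T. Proof. exact: lt_le_trans ltr01 T_ge1. Qed.
Let kappa_ge0 : 0 <= kappa.
Proof. by rewrite !mulr_ge0 ?powR_ge0 ?ler0n // ltW. Qed.

Lemma bucket_geometric e : (bucket G e)%:R <= kappa * (2 `^ (1 - alpha)) ^+ e.
Proof.
have p0 : 0 < (2 ^ e)%:R :> R by rewrite ltr0n expn_gt0.
have := PLB_bucket c1_gt0 (ltW alpha_gt0) t_ge0 GPLB p0 (_ : _ <= (2 ^ e)%:R + t).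
by rewrite lerDl -powR_pow2 (powRD_gt0 1) // (powRr1 (ltW p0)) => /(_ t_ge0).
Qed.

Lemma weighted_bucket_geometric e :
  (4 ^ e.+1 * bucket G e)%:R <= 4 * kappa * (2 `^ (3 - alpha)) ^+ e.
Proof.
have -> : 2 `^ (3 - alpha) = 4 * 2 `^ (1 - alpha) :> R.
  have -> : 3 - alpha = 2%:R + (1 - alpha) by ring.
  by rewrite powRD_gt0 ?ltr0n // powR_mulrn ?ler0n //; congr (_ * _); ring.
rewrite natrM natrX exprS exprMn.
have := bucket_geometric e.
rewrite -(ler_pM2l (_ : 0 < 4 * 4 ^+ e)) => [|]; last by rewrite -exprS exprn_gt0.
by move=> h; apply: le_trans h _; apply: ler_of_eq; ring.
Qed.

Lemma weighted_bucket_cube e :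
  (4 ^ e.+1 * bucket G e)%:R <= 4 * kappa * T `^ (- alpha) * 8 ^+ e.
Proof.
have le_T : T <= (2 ^ e)%:R + t by rewrite /T addrC lerD2r ler1n expn_gt0.
have := PLB_bucket c1_gt0 (ltW alpha_gt0) t_ge0 GPLB T_gt0 le_T.
rewrite -/T -/kappa natrM (natrX _ 4) exprS.
rewrite -(ler_pM2l (_ : 0 < 4 * 4 ^+ e)) => [|]; last by rewrite -exprS exprn_gt0.
move=> h; apply: le_trans h _; apply: ler_of_eq.
have -> : 8 ^+ e = 4 ^+ e * (2 ^ e)%:R :> R by rewrite natrX -exprMn; congr (_ ^+ _); ring.
by ring.
Qed.

Variable pos : 'I_n -> nat.
Hypothesis pos_mono : forall u v, (deg G u < deg G v)%N -> (pos u < pos v)%N.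

Let S : R := (\sum_v outdeg G pos v ^ 2)%:R.

Lemma outdeg_squares_lt3 : alpha < 3 -> (1 <= n)%N ->
  S <= (4 * c1 * 2 `^ (3 - alpha) / (2 `^ (3 - alpha) - 1)
        + (c1 / (1 - 2 `^ (1 - alpha))) ^+ 3)
       * (n%:R `^ (3 / alpha) * T `^ (3 - 3 / alpha)).
Proof.
move=> alpha_lt3 n_ge1.
set q := 2 `^ (3 - alpha); set p := 2 `^ (1 - alpha).
have q_gt1 : 1 < q by apply: gt1_pow2; rewrite subr_gt0.
have p_lt1 : p < 1 by apply: lt1_pow2; rewrite subr_lt0.
have p_gt0 : 0 < p by apply: powR_gt0.
(* [K] is [kappa] without the factor [c1], so that the threshold [D] is at least 1 however small
   [c1] is. *)
pose K := n%:R * T `^ (alpha - 1).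
have K_ge1 : 1 <= K.
  rewrite -[1]mulr1 ler_pM ?ler01 ?ler1n //.
  by rewrite -[X in X <= _](powRr0 T) ler_powR // subr_ge0 ltW.
have kE : kappa = c1 * K by rewrite /kappa mulrA.
pose D := K `^ alpha^-1.
have D_ge1 : 1 <= D by rewrite -(powRr0 K) ler_powR // invr_ge0 ltW.
have D_gt0 : 0 < D := lt_le_trans ltr01 D_ge1.
have DK : D `^ alpha = K.
  by rewrite -powRrM mulVf ?gt_eqF // powRr1 // (le_trans ler01).
have kD r : kappa * D `^ r = c1 * D `^ (alpha + r).
  by rewrite kE -DK powRD_gt0 // mulrA.
have D3 : D ^+ 3 = n%:R `^ (3 / alpha) * T `^ (3 - 3 / alpha).
  rewrite -(powR_mulrn 3 (ltW D_gt0)) -powRrM powRM ?powR_ge0 ?ler0n // -powRrM.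
  by congr (_ `^ _ * _ `^ _); field; rewrite gt_eqF.
rewrite -D3.
have [m [Dm mD]] := ge1_pow2 D_ge1.
have m_gt0 : 0 < (2 ^ m)%:R :> R := lt_trans D_gt0 Dm.
apply: le_trans (_ : ((\sum_(e < m) 4 ^ e.+1 * bucket G e)%N
    + (\sum_(e < n) bucket G (m + e)) ^ 3)%N%:R <= _).
  by rewrite ler_nat sum_outdeg_split.
rewrite natrD natrX mulrDl; apply: lerD.
  rewrite natr_sum.
  apply: le_trans (ler_sum _ (fun (e : 'I_m) _ => weighted_bucket_geometric e)) _.
  rewrite -mulr_sumr -/q.
  apply: le_trans (ler_wpM2l _ (geometric_sum_ge m q_gt1)) _.
    by rewrite mulr_ge0.
  (* [q ^+ m] is [2 ^ m] to the positive power [3 - alpha], and [2 ^ m] is at most [2 * D]. *)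
  have qm : q ^+ m <= q * D `^ (3 - alpha).
    have -> : q * D `^ (3 - alpha) = (2 * D) `^ (3 - alpha).
      by rewrite powRM ?ler0n // ltW.
    rewrite /q -(powR_pow2 m (3 - alpha)).
    apply: ge0_ler_powR; rewrite ?nnegrE //; first by rewrite subr_ge0 ltW.
    by rewrite mulr_ge0 ?ler0n ?(ltW D_gt0).
  have := kD (3 - alpha); rewrite [alpha + _]addrC subrK (powR_mulrn 3 (ltW D_gt0)) => kD3.
  apply: le_trans (_ : 4 * kappa * (q * D `^ (3 - alpha) / (q - 1)) <= _).
    apply: ler_wpM2l; first by rewrite mulr_ge0.
    by apply: ler_wpM2r => //; rewrite invr_ge0 subr_ge0 ltW.
  apply: ler_of_eq; transitivity (4 * (kappa * D `^ (3 - alpha)) * q / (q - 1)); first by ring.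
  by rewrite kD3; ring.
(* High degrees: the cube is monotone, so it suffices to bound their number by a constant times [D],
   through a decreasing geometric series whose first term is at most [c1 * D]. *)
rewrite -exprMn lerXn2r ?nnegrE ?ler0n //.
  by rewrite !mulr_ge0 ?invr_ge0 ?subr_ge0 ?(ltW c1_gt0) ?(ltW p_lt1) ?(ltW D_gt0).
rewrite natr_sum.
apply: le_trans (ler_sum _ (fun (e : 'I_n) _ => bucket_geometric (m + e))) _.
rewrite -/p (eq_bigr (fun e : 'I_n => kappa * p ^+ m * p ^+ e)) => [|e _]; last first.
  by rewrite exprD mulrA.
rewrite -mulr_sumr.
apply: le_trans (ler_wpM2l _ (geometric_sum_le n p_gt0 p_lt1)) _.
  by rewrite mulr_ge0 // exprn_ge0 // ltW.
rewrite [leRHS]mulrAC; apply: ler_wpM2r; first by rewrite invr_ge0 subr_ge0 ltW.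
have -> : c1 * D = kappa * D `^ (1 - alpha) by rewrite kD [alpha + _]addrC subrK powRr1 // ltW.
apply: ler_wpM2l => //; rewrite /p -powR_pow2.
by apply: powR_anti (ltW Dm) _; rewrite // subr_le0 ltW.
Qed.

Lemma outdeg_squares_eq3 : alpha = 3 -> (2 <= n)%N ->
  S <= 8 * c1 * (n%:R * log2 n%:R * T ^+ 2).
Proof.
move=> alpha3 n_ge2.
have n_gt0 : (0 < n)%N := ltnW n_ge2.
pose l := trunc_log 2 n.
have /andP[lo hi] := trunc_log_bounds (isT : (1 < 2)%N) n_gt0.
apply: le_trans (_ : (\sum_(e < l.+1) 4 ^ e.+1 * bucket G e)%N%:R <= _).
  by rewrite ler_nat; apply: sum_outdeg_all => //; apply: ltnW.
rewrite natr_sum.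
apply: le_trans (ler_sum _ (fun (e : 'I_l.+1) _ => weighted_bucket_geometric e)) _.
rewrite (eq_bigr (fun=> 4 * kappa)) => [|e _]; last first.
  by rewrite alpha3 subrr powRr0 expr1n mulr1.
rewrite sumr_const card_ord -[_ *+ l.+1]mulr_natr.
have -> : kappa = c1 * n%:R * T ^+ 2.
  rewrite /kappa alpha3 (_ : 3 - 1 = 2%:R) ?powR_mulrn //; first exact: ltW.
  by ring.
(* Here [n >= 2] matters: [log2 n >= 1] pays for the extra scale. *)
have h : l.+1%:R <= 2 * log2 (n%:R : R).
  have h1 : 1 <= log2 (n%:R : R) by apply: (@le_log2 1).
  have h2 := le_log2 lo.
  by rewrite -natr1 mulr_natl mulr2n; apply: lerD.
have c0 : 0 <= 4 * (c1 * n%:R * T ^+ 2) by rewrite !mulr_ge0 ?exprn_ge0 ?ler0n ?(ltW c1_gt0) ?(ltW T_gt0).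
apply: le_trans (ler_wpM2l c0 h) _; apply: ler_of_eq; ring.
Qed.

Lemma outdeg_squares_gt3 : 3 < alpha ->
  S <= 4 * c1 * (2 + (1 - 2 `^ (3 - alpha))^-1) * (n%:R * T ^+ 2).
Proof.
move=> alpha_gt3; set q := 2 `^ (3 - alpha).
have q_lt1 : q < 1 by apply: lt1_pow2; rewrite subr_lt0.
have q_gt0 : 0 < q by apply: powR_gt0.
(* The scales are split near [T]: below [m] the cubic bound is used, from [m] on the geometric
   one. *)
have [m [Tm mT]] := ge1_pow2 T_ge1.
have m_gt0 : 0 < (2 ^ m)%:R :> R := lt_trans T_gt0 Tm.
have kT : kappa * T `^ (3 - alpha) = c1 * (n%:R * T ^+ 2).
  rewrite /kappa -mulrA -powRD_gt0 // (_ : alpha - 1 + (3 - alpha) = 2%:R); last by ring.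
  by rewrite (powR_mulrn 2 (ltW T_gt0)) mulrA.
apply: le_trans (_ : (\sum_(e < m + n) 4 ^ e.+1 * bucket G e)%N%:R <= _).
  rewrite ler_nat; apply: sum_outdeg_all => //.
  by apply: leq_trans (ltnW (ltn_expl n (isT : 1 < 2)%N)) _; rewrite leq_exp2l // leq_addl.
rewrite big_split_ord natrD /=.
rewrite [leRHS](_ : _ = 8 * (c1 * (n%:R * T ^+ 2)) + 4 * (c1 * (n%:R * T ^+ 2)) / (1 - q));
  last by ring.
rewrite !natr_sum; apply: lerD.
  apply: le_trans (ler_sum _ (fun (e : 'I_m) _ => weighted_bucket_cube e)) _.
  rewrite -mulr_sumr.
  have lt_1_8 : 1 < 8 :> R by rewrite ltr1n.
  apply: le_trans (ler_wpM2l _ (geometric_sum_ge m lt_1_8)) _.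
    by rewrite mulr_ge0 ?powR_ge0 ?(mulr_ge0 _ kappa_ge0).
  have h : 8 ^+ m <= 8 * T `^ 3.
    have -> : 8 ^+ m = (2 ^ m)%:R ^+ 3 :> R.
      by rewrite natrX -exprM mulnC exprM; congr (_ ^+ _); ring.
    rewrite (powR_mulrn 3 (ltW T_gt0)) (_ : 8 = 2 ^+ 3); last by ring.
    by rewrite -exprMn lerXn2r ?nnegrE ?mulr_ge0 ?ler0n ?(ltW T_gt0).
  rewrite -kT [3 - alpha]addrC (powRD_gt0 _ 3 T_gt0).
  set x := T `^ (- alpha); set y := T `^ 3 in h *.
  have x0 : 0 <= kappa * x by rewrite mulr_ge0 // powR_ge0.
  have y0 : 0 <= y by apply: powR_ge0.
  rewrite (_ : 8 * (kappa * (x * y)) = 4 * kappa * x * (2 * y)); last by ring.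
  apply: ler_wpM2l; first by rewrite -mulrA mulr_ge0.
  (* The series of powers of 8 costs a factor 8/7, rounded up to 2. *)
  by rewrite (_ : 8 - 1 = 7); [rewrite ler_pdivrMr; lra | ring].
apply: le_trans (ler_sum _ (fun (e : 'I_n) _ => weighted_bucket_geometric (m + e))) _.
rewrite -/q (eq_bigr (fun e : 'I_n => 4 * kappa * q ^+ m * q ^+ e)) => [|e _]; last first.
  by rewrite exprD mulrA.
rewrite -mulr_sumr.
apply: le_trans (ler_wpM2l _ (geometric_sum_le n q_gt0 q_lt1)) _.
  by apply: mulr_ge0; [apply: mulr_ge0|apply: exprn_ge0; apply: ltW].
apply: ler_wpM2r; first by rewrite invr_ge0 subr_ge0 ltW.
rewrite -kT -mulrA ler_pM2l ?ltr0n //.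
apply: ler_wpM2l => //; rewrite /q -powR_pow2.
by apply: powR_anti (ltW Tm) _; rewrite // subr_le0 ltW.
Qed.

End OutdegreeSquares.

(** For [n >= 1] the linear part satisfies [3000 * (n + 1) <= 6000 * n <= 6000 * X]; the sum of
    squares supplies the rest. *)
Lemma CountTriangles_bound (R : realType) n (G : sgraph n) s (C X : R) :
  encodes G s -> 0 <= C ->
  (forall pos : 'I_n -> nat, (forall u v, (deg G u < deg G v)%N -> (pos u < pos v)%N) ->
     (\sum_v outdeg G pos v ^ 2)%N%:R <= C * X) ->
  (1 <= n)%N -> n%:R <= X ->
  (exec CountTriangles s).2%:R <= (6000 + 500 * C) * X.
Proof.
move=> Gs C0 H n1 nX; have [pos [_ mono [_ time]]] := CountTriangles_run Gs.
have := H pos mono; move: time; rewrite -(ler_nat R).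
set S := \sum_v _; rewrite natrD !natrM -natr1 => time SX.
have n1' : 1 <= n%:R :> R by rewrite ler1n.
lra.
Qed.

Theorem theorem5p4 (R : realType) (c1 alpha : R) (hc1 : 0 < c1) (halpha : 1 < alpha) :
  exists2 C : R, 0 < C &
    forall (n : nat) (G : sgraph n) (t : R), 0 <= t -> PLB c1 alpha t G ->
    forall s : store, encodes G s ->
      regs (exec CountTriangles s).1 rCount = #|triangles G| /\
      let time : R := (exec CountTriangles s).2%:R in
      [/\ alpha < 3 -> (1 <= n)%N ->
            time <= C * (n%:R `^ (3 / alpha) * (t + 1) `^ (3 - 3 / alpha)),
          alpha = 3 -> (2 <= n)%N ->
            time <= C * (n%:R * log2 n%:R * (t + 1) ^+ 2)
        & 3 < alpha -> (1 <= n)%N ->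
            time <= C * (n%:R * (t + 1) ^+ 2)].
Proof.
have alpha_gt0 : 0 < alpha := lt_trans ltr01 halpha.
suff [C C0 H] : exists2 C : R, 0 <= C &
    forall (n : nat) (G : sgraph n) (t : R), 0 <= t -> PLB c1 alpha t G ->
    forall s : store, encodes G s ->
      let time : R := (exec CountTriangles s).2%:R in
      [/\ alpha < 3 -> (1 <= n)%N ->
            time <= (6000 + 500 * C) * (n%:R `^ (3 / alpha) * (t + 1) `^ (3 - 3 / alpha)),
          alpha = 3 -> (2 <= n)%N ->
            time <= (6000 + 500 * C) * (n%:R * log2 n%:R * (t + 1) ^+ 2)
        & 3 < alpha -> (1 <= n)%N ->
            time <= (6000 + 500 * C) * (n%:R * (t + 1) ^+ 2)].
  exists (6000 + 500 * C); first by lra.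
  move=> n G t t0 GP s Gs; split; last exact: H.
  by have [pos [_ _ []]] := CountTriangles_run Gs.
have T1 (t : R) : 0 <= t -> 1 <= t + 1 by move=> ?; rewrite lerDr.
have nT (n : nat) (t : R) : 0 <= t -> n%:R <= n%:R * (t + 1) ^+ 2.
  by move=> t0; rewrite ler_peMr ?ler0n // exprn_ege1 // T1.
(* The constant may depend on [alpha], so it is chosen per range; the other two clauses are then
   vacuous. *)
case: (ltgtP alpha 3) => alpha3.
- pose C := 4 * c1 * 2 `^ (3 - alpha) / (2 `^ (3 - alpha) - 1)
            + (c1 / (1 - 2 `^ (1 - alpha))) ^+ 3.
  have C_ge0 : 0 <= C.
    have q1 : 1 < 2 `^ (3 - alpha) :> R by apply: gt1_pow2; rewrite subr_gt0.
    have p1 : 2 `^ (1 - alpha) < 1 :> R by apply: lt1_pow2; rewrite subr_lt0.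
    rewrite addr_ge0 ?exprn_ge0 ?mulr_ge0 ?invr_ge0 ?subr_ge0 ?powR_ge0 ?ler0n //;
      exact: ltW.
  exists C => //.
  move=> n G t t0 GP s Gs; split=> [_ n1|e|//]; last by rewrite e ltxx in alpha3.
  apply: (CountTriangles_bound Gs) => //.
  + by move=> pos mono; apply: outdeg_squares_lt3.
  (* [n <= X] because [3 / alpha >= 1] and [3 - 3 / alpha >= 0], with both bases at least 1. *)
  + rewrite -[leLHS]mulr1 ler_pM ?ler01 ?ler0n //.
      by rewrite le1r_powR ?ler1n // ler_pdivlMr // mul1r ltW.
    rewrite -[leLHS](powRr0 (t + 1)) ler_powR ?T1 //.
    by rewrite subr_ge0 ler_pdivrMr // -[leLHS]mulr1 ler_pM2l // ltW.
- pose C := 4 * c1 * (2 + (1 - 2 `^ (3 - alpha))^-1).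
  have C_ge0 : 0 <= C.
    have q1 : 2 `^ (3 - alpha) < 1 :> R by apply: lt1_pow2; rewrite subr_lt0.
    by rewrite !mulr_ge0 ?addr_ge0 ?invr_ge0 ?subr_ge0 ?ler0n ?(ltW hc1) ?(ltW q1).
  exists C => //.
  move=> n G t t0 GP s Gs; split=> [//|e|_ n1]; first by rewrite e ltxx in alpha3.
  apply: (CountTriangles_bound Gs) => //; last exact: nT.
  + by move=> pos mono; apply: outdeg_squares_gt3.
- exists (8 * c1); first by rewrite mulr_ge0 ?ler0n // ltW.
  move=> n G t t0 GP s Gs; split=> [//|_ n2|//].
  have n_gt0 : (1 <= n)%N := ltnW n2.
  apply: (CountTriangles_bound Gs) => //.
  + by rewrite mulr_ge0 ?ler0n // ltW.
  + by move=> pos mono; apply: (outdeg_squares_eq3 hc1 halpha).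
  + apply: le_trans (nT n t t0) _; apply: ler_wpM2r; first by rewrite exprn_ge0 // ltW // ltr_wpDl.
    by rewrite ler_peMr ?ler0n //; apply: (@le_log2 R 1).
Qed.
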